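(* Let $V$ be an $\mathbb{F}_q$-vector space of finite dimension $r\ge1$. For all $n\in\mathbb{Z}$ the homogeneous part $R_{V,-n}$ of $R_V$ of degree $-n$ has dimension over $\mathbb{F}_q$ $$\dim R_{V,-n}=\begin{cases} h_r(n) & \text{if } n\ge0,\\ 0&\text{if } n<0,\end{cases}$$ where $$h_r(T):=\sum_{I\subset\{2,\ldots,r\}} q^{\sum_{i\in I}(i-1)}\cdot\binom{T}{|I|}\ \in\ \mathbb{Q}[T],$$ the sum being over all subsets $I$ of $\{2,\ldots,r\}$, including the empty set.
   Context: $\mathbb{F}_q$ is a finite field with $q$ elements. Let $S_V$ be the symmetric algebra of $V$ over $\mathbb{F}_q$, $K_V$ its field of quotients, and $R_V\subset K_V$ the $\mathbb{F}_q$-subalgebra generated by $\frac1v$ for all $v\in V\setminus\{0\}$. The algebra $R_V$ is $\mathbb{Z}$-graded such that each $\frac1v$ is homogeneous of degree $-1$; thus it is graded in degrees $\le0$. The set $\{2,\ldots,r\}$ is the set of integers $i$ with $2\le i\le r$ (empty if $r=1$), and $|I|$ denotes the cardinality of $I$. $\binom{T}{k}=\frac{T(T-1)\cdots(T-k+1)}{k!}$. *)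

(* Defs.v *)
From HB Require Import structures.
From mathcomp Require Import all_boot all_order all_algebra.
From mathcomp.multinomials Require Import mpoly.

Set Implicit Arguments.
Unset Strict Implicit.
Unset Printing Implicit Defensive.

Import Order.TTheory GRing.Theory Num.Theory.

Local Open Scope ring_scope.

(* The symmetric algebra S_V, modelled as the polynomial ring on the          *)
(* coordinates of a basis of V; [sym_iota] is the embedding of V into S_V.    *)
(* That this is a symmetric algebra is [sym_universal] below.                 *)
Definition sym (F : fieldType) (V : vectType F) := {mpoly F[\dim {:V}]}.

HB.instance Definition _ (F : fieldType) (V : vectType F) :=
  GRing.IntegralDomain.on (sym V).
HB.instance Definition _ (F : fieldType) (V : vectType F) :=
  GRing.ComAlgebra.on (sym V).

Definition sym_iota (F : fieldType) (V : vectType F) (v : V) : sym V :=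
  \sum_(i < \dim {:V}) coord (vbasis {:V}) i v *: 'X_i.

Definition symfrac (F : fieldType) (V : vectType F) := {fraction (sym V)}.

HB.instance Definition _ (F : fieldType) (V : vectType F) :=
  GRing.Field.on (symfrac V).

Definition sym_frac (F : fieldType) (V : vectType F) : sym V -> symfrac V :=
  @FracField.tofrac (sym V).

HB.instance Definition _ (F : fieldType) (V : vectType F) :=
  GRing.RMorphism.copy (@sym_frac F V) (@FracField.tofrac (sym V)).

Section SymfracAlgebra.
Context (F : fieldType) (V : vectType F).
Implicit Types (a b : F) (x y : symfrac V).

Definition symfrac_scale a x : symfrac V := sym_frac (a%:A : sym V) * x.

Fact symfrac_scalerA a b x :
  symfrac_scale a (symfrac_scale b x) = symfrac_scale (a * b) x.
Proof.
by rewrite /symfrac_scale mulrA -rmorphM /= -scalerAl mul1r scalerA.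
Qed.

Fact symfrac_scale1r : left_id 1 symfrac_scale.
Proof. by move=> x; rewrite /symfrac_scale scale1r rmorph1 mul1r. Qed.

Fact symfrac_scalerDr : right_distributive symfrac_scale +%R.
Proof. by move=> a x y; rewrite /symfrac_scale mulrDr. Qed.

Fact symfrac_scalerDl x :
  {morph symfrac_scale^~ x : a b / a + b >-> a + b}.
Proof. by move=> a b; rewrite /symfrac_scale scalerDl rmorphD mulrDl. Qed.

HB.instance Definition _ := GRing.Zmodule_isLmodule.Build F (symfrac V)
  symfrac_scalerA symfrac_scale1r symfrac_scalerDr symfrac_scalerDl.

Fact symfrac_scalerAl a x y : a *: (x * y) = (a *: x) * y.
Proof. exact: mulrA. Qed.

HB.instance Definition _ := GRing.Lmodule_isLalgebra.Build F (symfrac V)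
  symfrac_scalerAl.
HB.instance Definition _ := GRing.Lalgebra_isComAlgebra.Build F (symfrac V).

End SymfracAlgebra.

Definition is_subspace (F : fieldType) (L : lmodType F) (P : L -> Prop) :=
  P 0 /\ (forall (a : F) (u v : L), P u -> P v -> P (a *: u + v)).

Definition is_subalg (F : fieldType) (A : comAlgType F) (P : A -> Prop) :=
  [/\ is_subspace P, P 1 & forall u v : A, P u -> P v -> P (u * v)].

Definition gen_subalg (F : fieldType) (A : comAlgType F) (S : A -> Prop)
    (x : A) : Prop :=
  forall P : A -> Prop, is_subalg P -> (forall s, S s -> P s) -> P x.

Definition has_dim (F : fieldType) (L : lmodType F) (P : L -> Prop)
    (d : nat) : Prop :=
  exists e : 'I_d -> L,
    [/\ forall i, P (e i),
        forall c : 'I_d -> F, \sum_i c i *: e i = 0 -> forall i, c i = 0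
      & forall x, P x -> exists c : 'I_d -> F, x = \sum_i c i *: e i].

Section RV.
Context (F : fieldType) (V : vectType F).

Definition sym_inv (v : V) : symfrac V := (sym_frac (sym_iota v))^-1.

Definition RV : symfrac V -> Prop :=
  gen_subalg (fun x : symfrac V => exists2 v : V, v != 0 & x = sym_inv v).

(* Elements of degree d for the Z-grading on the ring of fractions of S_V     *)
(* with homogeneous denominators, S_V being graded by total degree.           *)
Definition symfrac_homog (d : int) (x : symfrac V) : Prop :=
  exists (i j : nat) (f g : sym V),
    [/\ f \is i.-homog, g \is j.-homog, g != 0,
        d = i%:Z - j%:Z & x = sym_frac f / sym_frac g].

(* The homogeneous part of R_V of degree d.  By [RVdeg_grading],              *)
(* [RVdeg_inv] and [RVdeg_unique] below, this is the one and only Z-grading   *)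
(* of R_V for which every 1/v is homogeneous of degree -1 (when V != 0).      *)
Definition RVdeg (d : int) (x : symfrac V) : Prop := RV x /\ symfrac_homog d x.

End RV.

Definition is_grading (F : fieldType) (A : comAlgType F) (R : A -> Prop)
    (G : int -> A -> Prop) : Prop :=
  [/\ forall d, is_subspace (G d) /\ (forall x, G d x -> R x),
      G 0 1 /\ (forall d e x y, G d x -> G e y -> G (d + e) (x * y)),
      forall x, R x -> exists (s : seq int) (y : int -> A),
        [/\ uniq s, forall d, G d (y d) & x = \sum_(d <- s) y d]
    & forall (s : seq int) (y : int -> A), uniq s -> (forall d, G d (y d)) ->
        \sum_(d <- s) y d = 0 -> forall d, d \in s -> y d = 0].

Definition binom_poly (k : nat) : {poly rat} :=
  (k`!%:R)^-1 *: \prod_(j < k) ('X - (j%:R)%:P).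

(* Subsets I of {2, ..., r} are encoded as sets of ordinals below r.+1.       *)
Definition h_poly (q r : nat) : {poly rat} :=
  \sum_(I : {set 'I_r.+1} | I \subset [set i : 'I_r.+1 | (2 <= i)%N])
     (q ^ (\sum_(i in I) (i - 1)))%N%:R *: binom_poly #|I|.

Section Universal.
Context (F : fieldType) (V : vectType F).

Fact sym_iota_is_linear : linear (@sym_iota F V).
Proof.
move=> a u v; rewrite /sym_iota scaler_sumr -big_split /=.
by apply: eq_bigr => i _; rewrite linearP scalerDl scalerA.
Qed.

HB.instance Definition _ := GRing.isLinear.Build F V (sym V) _ (@sym_iota F V)
  sym_iota_is_linear.

Lemma sym_iota_basis (i : 'I_(\dim {:V})) :
  sym_iota (vbasis {:V})`_i = 'X_i :> sym V.
Proof.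
rewrite /sym_iota (bigD1 i) //= coord_free ?(basis_free (vbasisP _)) // eqxx.
rewrite scale1r big1 ?addr0 // => j nij.
by rewrite coord_free ?(basis_free (vbasisP _)) // eq_sym (negPf nij) scale0r.
Qed.

Lemma sym_iota_inj : injective (@sym_iota F V).
Proof.
move=> u v eq_uv; rewrite [u](coord_vbasis (memvf u)) [v](coord_vbasis (memvf v)).
apply: eq_bigr => i _; congr (_ *: _).
have cE w : (sym_iota w)@_(U_(i)) = coord (vbasis {:V}) i w.
  rewrite /sym_iota linear_sum (bigD1 i) //= mcoeffZ mcoeffXU eqxx mulr1.
  rewrite big1 ?addr0 // => j nij.
  by rewrite mcoeffZ mcoeffXU (negPf nij) mulr0.
by rewrite -!cE eq_uv.
Qed.

Lemma sym_iota_eq0 (v : V) : (sym_iota v == 0) = (v == 0).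
Proof. by rewrite -(inj_eq sym_iota_inj) linear0. Qed.

Lemma sym_iota_homog (v : V) : (sym_iota v : {mpoly F[_]}) \is 1.-homog.
Proof. by apply: rpred_sum => i _; apply: rpredZ; rewrite dhomogX /= mdeg1. Qed.

Lemma sym_universal (A : comAlgType F) (f : {linear V -> A}) :
  (exists g : {lrmorphism sym V -> A}, forall v, g (sym_iota v) = f v) /\
  (forall g h : {lrmorphism sym V -> A},
     (forall v, g (sym_iota v) = h (sym_iota v)) -> g =1 h).
Proof.
split.
  pose b (i : 'I_(\dim {:V})) := f (vbasis {:V})`_i.
  pose m : sym V -> A := mmap (GRing.in_alg A) b.
  have mD : zmod_morphism m by exact: mmap_is_additive.
  have mM : monoid_morphism m.
    by have [h1 h2] := mmap_is_multiplicative b (GRing.in_alg A).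
  have mZ : scalable m.
    by move=> a p; rewrite /m mmapZ /= mulr_algl.
  pose mA := GRing.isZmodMorphism.Build _ _ m mD.
  pose mB := GRing.isMonoidMorphism.Build _ _ m mM.
  pose mC := GRing.isScalable.Build _ _ _ _ m mZ.
  pose g : {lrmorphism sym V -> A} := HB.pack m mA mB mC.
  exists g => v; rewrite [in RHS](coord_vbasis (memvf v)) [RHS]linear_sum.
  rewrite /sym_iota [LHS]linear_sum; apply: eq_bigr => i _.
  by rewrite [LHS]linearZ [RHS]linearZ /= /m mmapX mmap1U.
move=> g h eq_gh p; rewrite [p]mpolyE (raddf_sum g) (raddf_sum h) /=.
apply: eq_bigr => m _; rewrite !linearZ /=; congr (_ *: _).
rewrite mpolyXE_id (rmorph_prod g) (rmorph_prod h) /=.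
by apply: eq_bigr => i _; rewrite !rmorphXn /= -sym_iota_basis eq_gh.
Qed.

End Universal.

Section Grading.
Context (F : fieldType) (V : vectType F).
Implicit Types (x y : symfrac V) (G : int -> symfrac V -> Prop).

Fact frac_expand (K : fieldType) (u v w : K) :
  w != 0 -> (u / v = (u * w) / (v * w)) * (u / v = (w * u) / (w * v)).
Proof.
by move=> w0; split; rewrite -mulf_div divff // ?mulr1 ?mul1r.
Qed.

Lemma sym_frac_inj : injective (@sym_frac F V).
Proof. by move=> p q /eqP; rewrite tofrac_eq => /eqP. Qed.

Lemma sym_frac_eq0 (p : sym V) : (sym_frac p == 0) = (p == 0).
Proof. exact: tofrac_eq0. Qed.

Lemma sym_fracZ a (p : sym V) : sym_frac (a *: p) = a *: sym_frac p.
Proof. by rewrite -mulr_algl rmorphM. Qed.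

Lemma RV_subalg : is_subalg (@RV F V).
Proof.
split; first split.
- by move=> P [[P0 _] _ _] _.
- move=> a u v Ru Rv P Palg PS; have [[_ PD] _ _] := Palg.
  by apply: PD; [apply: Ru | apply: Rv].
- by move=> P [_ P1 _] _.
- move=> u v Ru Rv P Palg PS; have [_ _ PM] := Palg.
  by apply: PM; [apply: Ru | apply: Rv].
Qed.


Lemma symfrac_homogM d e x y :
  symfrac_homog d x -> symfrac_homog e y -> symfrac_homog (d + e) (x * y).
Proof.
move=> [i [j [f [g [fi gj g0 -> ->]]]]] [k [l [p [q [pk ql q0 -> ->]]]]].
exists (i + k)%N, (j + l)%N, (f * p), (g * q); split.
- exact: dhomogM.
- exact: dhomogM.
- by rewrite mulf_neq0.
- by rewrite !PoszD opprD addrACA.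
- by rewrite !rmorphM /= invfM mulrACA.
Qed.

Lemma symfrac_homog1 : @symfrac_homog F V 0 1.
Proof.
exists 0%N, 0%N, 1, 1; split; rewrite ?oner_neq0 ?subrr //; try exact: dhomog1.
by rewrite rmorph1 divr1.
Qed.

Lemma symfrac_homog_inv (v : V) : v != 0 -> symfrac_homog (- 1) (sym_inv v).
Proof.
move=> v0; exists 0%N, 1%N, 1, (sym_iota v); split => //.
- exact: dhomog1.
- exact: sym_iota_homog.
- by rewrite sym_iota_eq0.
- by rewrite rmorph1 mul1r.
Qed.

Lemma RVdeg_inv (v : V) : v != 0 -> RVdeg (- 1) (sym_inv v).
Proof.
move=> v0; split; last exact: symfrac_homog_inv.
by move=> P _; apply; exists v.
Qed.

Lemma symfrac_homogP d a x y :
  symfrac_homog d x -> symfrac_homog d y -> symfrac_homog d (a *: x + y).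
Proof.
move=> [i [j [f [g [fi gj g0 dE ->]]]]] [k [l [p [q [pk ql q0 dE' ->]]]]].
have eil : (k + j = i + l)%N.
  by apply/eqP; rewrite -eqz_nat !PoszD -subr_eq addrAC -dE' dE subrK.
exists (i + l)%N, (j + l)%N, (a *: (f * q) + p * g), (g * q); split.
- by apply: rpredD; [apply: rpredZ; apply: dhomogM | rewrite -eil; apply: dhomogM].
- exact: dhomogM.
- by rewrite mulf_neq0.
- by rewrite !PoszD opprD addrACA subrr addr0.
- have fg0 : sym_frac g != 0 by rewrite sym_frac_eq0.
  have fq0 : sym_frac q != 0 by rewrite sym_frac_eq0.
  rewrite rmorphD /= sym_fracZ !rmorphM /= mulrDl -!scalerAl.
  rewrite -(frac_expand _ _ fq0).1 (mulrC (sym_frac p) (sym_frac g)).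
  by rewrite -(frac_expand _ _ fg0).2.
Qed.

Context (dimV_gt0 : (0 < \dim {:V})%N).

Lemma symfrac_homog0 d : @symfrac_homog F V d 0.
Proof.
have [i [j dE]] : exists i j : nat, d = i%:Z - j%:Z.
  case: d => [i|i]; first by exists i, 0%N; rewrite subr0.
  by exists 0%N, i.+1; rewrite sub0r NegzE.
exists i, j, 0, ('X_(Ordinal dimV_gt0) ^+ j); split => //.
- exact: rpred0.
- rewrite -[X in X.-homog]mul1n; apply: dhomogMn.
  by rewrite dhomogX /= mdeg1.
- by rewrite expf_neq0 // -msize_poly_eq0 msizeX.
- by rewrite rmorph0 mul0r.
Qed.

Lemma RVdeg_subspace d : is_subspace (@RVdeg F V d).
Proof.
have [[R0 RP] _ _] := RV_subalg; split; first by split=> //; exact: symfrac_homog0.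
by move=> a u v [Ru hu] [Rv hv]; split; [exact: RP | exact: symfrac_homogP].
Qed.

Lemma symfrac_homog_indep (s : seq int) (y : int -> symfrac V) : uniq s ->
    (forall d, symfrac_homog d (y d)) -> \sum_(d <- s) y d = 0 ->
  forall d, d \in s -> y d = 0.
Proof.
move=> us hy sum0.
have [e [g [ge g0 gP]]] : exists (e : nat) (g : sym V),
    [/\ (g : {mpoly F[_]}) \is e.-homog, g != 0 & forall d, d \in s ->
      exists (i : nat) (f : sym V), [/\ (f : {mpoly F[_]}) \is i.-homog,
        i%:Z = d + e%:Z & y d = sym_frac f / sym_frac g]].
  elim: s {us sum0} => [|d s [e [g [ge g0 gP]]]].
    by exists 0%N, 1; split=> //; [exact: dhomog1 | rewrite oner_neq0].
  have [i [j [f [h [fi hj h0 dE yE]]]]] := hy d.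
  have fg0 : sym_frac g != 0 by rewrite sym_frac_eq0.
  have fh0 : sym_frac h != 0 by rewrite sym_frac_eq0.
  exists (j + e)%N, (h * g); split; [exact: dhomogM | by rewrite mulf_neq0 |].
  move=> d'; rewrite inE => /predU1P[->|/gP[i' [f' [fi' iE' yE']]]].
    exists (i + e)%N, (f * g); split; first exact: dhomogM.
      by rewrite dE !PoszD addrA subrK.
    by rewrite yE !rmorphM /= (frac_expand _ _ fg0).1.
  exists (j + i')%N, (h * f'); split; first exact: dhomogM.
    by rewrite !PoszD iE' addrCA.
  by rewrite yE' !rmorphM /= (frac_expand _ _ fh0).2.
have fg0 : sym_frac g != 0 by rewrite sym_frac_eq0.
have gC d : exists f : sym V, d \in s ->
    (f : {mpoly F[_]}) \is (absz (d + e%:Z)).-homog /\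
    (0 <= d + e%:Z) && (y d == sym_frac f / sym_frac g).
  have [/gP[i [f [fi iE ->]]]|_] := boolP (d \in s); last by exists 0.
  by exists f => _; rewrite -iE absz_nat eqxx.
have [f fP] : exists f : int -> sym V, forall d, d \in s ->
    (f d : {mpoly F[_]}) \is (absz (d + e%:Z)).-homog /\
    (0 <= d + e%:Z) && (y d == sym_frac (f d) / sym_frac g).
  elim: (s) gC => [|d0 t IH] gC; first by exists (fun=> 0).
  have [d|f fP] := IH.
    have [f0 f0P] := gC d; exists f0 => dt; apply: f0P; by rewrite inE dt orbT.
  have [f0 f0P] := gC d0.
  exists (fun d => if d == d0 then f0 else f d) => d; rewrite inE.
  by have [->|_] := eqVneq d d0; [move=> _; apply: f0P; rewrite inE eqxx | apply: fP].
have sf0 : \sum_(d <- s) f d = 0.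
  apply: sym_frac_inj; rewrite rmorph0 rmorph_sum /=.
  apply: (mulIf (invr_neq0 fg0)); rewrite mul0r -[RHS]sum0 mulr_suml.
  by rewrite !big_seq; apply: eq_bigr => d /fP[_ /andP[_ /eqP ->]].
move=> d ds; have [fd /andP[d0 /eqP ->]] := fP d ds.
suff -> : f d = 0 by rewrite rmorph0 mul0r.
have := congr1 (pihomog mdeg (absz (d + e%:Z))) sf0.
rewrite raddf_sum raddf0 (bigD1_seq d) //= pihomog_dE // big_seq_cond big1.
  by rewrite addr0.
move=> d' /andP[d's nd]; have [fd' /andP[d0' _]] := fP d' d's.
apply: (pihomog_ne0 _ fd'); apply: contraNneq nd => eqd.
by rewrite -(inj_eq (addIr e%:Z)) -[d' + _]gez0_abs // eqd gez0_abs.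
Qed.


Lemma sum_homogP G (t : seq (int * symfrac V)) :
    (forall d, is_subspace (G d)) -> (forall p, p \in t -> G p.1 p.2) ->
  exists (s : seq int) (y : int -> symfrac V),
    [/\ uniq s, forall d, G d (y d) & \sum_(p <- t) p.2 = \sum_(d <- s) y d].
Proof.
move=> Gsub Gt; exists (undup [seq p.1 | p <- t]).
exists (fun d => \sum_(p <- t | p.1 == d) p.2); split; first exact: undup_uniq.
  move=> d; have [G0 GP] := Gsub d; rewrite big_seq_cond.
  apply: big_ind => //; last by move=> p /andP[/Gt Gp /eqP <-].
  by move=> u v Gu Gv; rewrite -[u]scale1r; apply: GP.
rewrite (exchange_big_dep predT) //= big_seq [RHS]big_seq.
apply: eq_bigr => p pt; rewrite -big_filter.
have -> : [seq d <- undup [seq p.1 | p <- t] | p.1 == d] = [:: p.1].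
  rewrite (@eq_filter _ _ (pred1 p.1)); last by move=> d; rewrite /= eq_sym.
  by rewrite filter_pred1_uniq ?undup_uniq // mem_undup map_f.
by rewrite big_seq1.
Qed.

(* Every element of R_V is a sum of elements lying in the graded pieces of    *)
(* any multiplicative family of subspaces with 1/v in degree -1.              *)
Lemma RV_sum_homog G x :
    (forall d, is_subspace (G d)) -> G 0 1 ->
    (forall d e x y, G d x -> G e y -> G (d + e) (x * y)) ->
    (forall v : V, v != 0 -> G (- 1) (sym_inv v)) -> RV x ->
  exists2 t : seq (int * symfrac V),
    forall p, p \in t -> G p.1 p.2 & x = \sum_(p <- t) p.2.
Proof.
move=> Gsub G1 GM Ginv Rx.
apply: (Rx (fun x => exists2 t : seq (int * symfrac V),
  forall p, p \in t -> G p.1 p.2 & x = \sum_(p <- t) p.2)); last first.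
  move=> _ [v v0 ->]; exists [:: (- 1, sym_inv v)]; last by rewrite big_seq1.
  by move=> p; rewrite inE => /eqP ->; apply: Ginv.
split; first split.
- by exists [::] => //; rewrite big_nil.
- move=> a _ _ [t tG ->] [t' t'G ->].
  exists ([seq (p.1, a *: p.2) | p <- t] ++ t').
    move=> p; rewrite mem_cat => /orP[/mapP[p' /tG Gp' ->]|/t'G //] /=.
    by have [G0 GP] := Gsub p'.1; rewrite -[a *: _]addr0; apply: GP.
  by rewrite big_cat big_map scaler_sumr.
- exists [:: (0, 1)]; last by rewrite big_seq1.
  by move=> p; rewrite inE => /eqP ->.
- move=> _ _ [t tG ->] [t' t'G ->].
  exists [seq (p.1 + p'.1, p.2 * p'.2) | p <- t, p' <- t'].
    by move=> _ /allpairsP[[p p'] /= [/tG Gp /t'G Gp' ->]]; apply: GM.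
  rewrite big_allpairs_dep /= mulr_suml; apply: eq_bigr => p _.
  by rewrite mulr_sumr.
Qed.

Lemma RVdegM d e x y : RVdeg d x -> RVdeg e y -> RVdeg (d + e) (x * y).
Proof.
have [_ _ RM] := RV_subalg.
by move=> [Rx hx] [Ry hy]; split; [exact: RM | exact: symfrac_homogM].
Qed.

Lemma RVdeg1 : @RVdeg F V 0 1.
Proof. by have [_ R1 _] := RV_subalg; split=> //; exact: symfrac_homog1. Qed.

Lemma RVdeg_grading : is_grading (@RV F V) (@RVdeg F V).
Proof.
split.
- by move=> d; split; [exact: RVdeg_subspace | move=> x []].
- by split; [exact: RVdeg1 | exact: RVdegM].
- move=> x Rx; have [t tG ->] := RV_sum_homog RVdeg_subspace RVdeg1
    RVdegM RVdeg_inv Rx.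
  exact: sum_homogP RVdeg_subspace tG.
- by move=> s y us hy; apply: symfrac_homog_indep => // d; have [] := hy d.
Qed.

Lemma RVdeg_unique G : is_grading (@RV F V) G ->
    (forall v : V, v != 0 -> G (- 1) (sym_inv v)) ->
  forall d x, G d x <-> RVdeg d x.
Proof.
move=> gG Ginv.
have [GsubR [G1 GM] _ _] := gG.
pose H d x := G d x /\ RVdeg d x.
have Gsub d : is_subspace (G d) by have [] := GsubR d.
have Hsub d : is_subspace (H d).
  have [[G0 GP] [R0 RP]] := (Gsub d, RVdeg_subspace d).
  by split=> // a u v [? ?] [? ?]; split; [apply: GP | apply: RP].
have homogE G' d x (s : seq int) (y : int -> symfrac V) : is_grading (@RV F V) G' -> G' d x -> uniq s ->
    (forall d, G' d (y d)) -> x = \sum_(d <- s) y d -> x = 0 \/ x = y d.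
  move=> [G's _ _ ind] G'x us G'y xE.
  have G'sub d' : is_subspace (G' d') by have [] := G's d'.
  pose z d' := y d' - (if d' == d then x else 0).
  have G'z d' : G' d' (z d').
    have [G'0 G'P] := G'sub d'; rewrite /z; case: eqP => [->|_].
      by have [_ P] := G'sub d; rewrite addrC -scaleN1r; apply: P.
    by rewrite subr0.
  have [ds|nds] := boolP (d \in s); [right|left].
    apply/esym/eqP; rewrite -subr_eq0; apply/eqP.
    have := ind s z us G'z; rewrite /z sumrB -xE.
    rewrite -big_mkcond -big_filter filter_pred1_uniq // big_seq1 subrr.
    by move/(_ erefl d ds); rewrite eqxx.
  pose z' d' := if d' == d then - x else y d'.
  have G'z' d' : G' d' (z' d').
    rewrite /z'; case: eqP => [->|_] //; have [G'0 P] := G'sub d.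
    by rewrite -[- x]addr0 -scaleN1r; apply: P.
  have := ind (d :: s) z'; rewrite /= nds us => /(_ isT G'z').
  rewrite big_cons {1}/z' eqxx (_ : \sum_(j <- s) z' j = x).
    rewrite addNr => /(_ erefl d (mem_head _ _)); rewrite /z' eqxx.
    by move/eqP; rewrite oppr_eq0 => /eqP.
  rewrite xE !big_seq; apply: eq_bigr => d' d's.
  by rewrite /z'; case: eqP d's nds => // -> ->.
have HE G' d x : is_grading (@RV F V) G' ->
    (forall d x, H d x -> G' d x) -> G' d x -> H d x.
  move=> gG' HG' G'x; have [G's _ _ _] := gG'.
  have Rx : RV x by have [_] := G's d; apply.
  have HM d1 d2 x1 x2 : H d1 x1 -> H d2 x2 -> H (d1 + d2) (x1 * x2).
    by move=> [? ?] [? ?]; split; [apply: GM | apply: RVdegM].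
  have Hinv v : v != 0 -> H (- 1) (sym_inv v).
    by move=> v0; split; [apply: Ginv | apply: RVdeg_inv].
  have [t tH xE] := RV_sum_homog Hsub (conj G1 RVdeg1) HM Hinv Rx.
  have [s [y [us Hy tE]]] := sum_homogP Hsub tH.
  rewrite tE in xE.
  have [->|->] := homogE G' d x s y gG' G'x us (fun d' => HG' _ _ (Hy d')) xE.
    by have [] := Hsub d.
  exact: Hy.
move=> d x; split=> [Gx|Rx].
  by have [] := HE G d x gG (fun _ _ => @proj1 _ _) Gx.
by have [] := HE _ d x RVdeg_grading (fun _ _ => @proj2 _ _) Rx.
Qed.

End Grading.

(* Main.v *)
Require Import Defs.
From HB Require Import structures.
From mathcomp Require Import all_boot all_order all_algebra.
From mathcomp.multinomials Require Import mpoly.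

Import Order.TTheory GRing.Theory Num.Theory.

Local Open Scope ring_scope.

(** Why the formula holds.  Fix a basis of V, let b be one of its vectors and U
    the span of the preceding ones.  For distinct u, u' in U the identity
      1/(b+u) * 1/(b+u') = 1/(u'-u) * (1/(b+u) - 1/(b+u'))
    trades a product of two inverses taken in the same coset b + U for products
    with a single inverse from this coset and one from U.  Hence R_V is spanned
    by the normal monomials, which contain a power 1/(b+u)^m from at most one
    point of each coset b + U ([mon_span_mul], [mon_span_inv]).

    Normal monomials are linearly independent ([monomials_free]): with respect
    to the last basis vector b a relation between them is a partial fraction
    decomposition in the variable b over the field of fractions of S_U.  Its
    polar coefficients at b = -u vanish, because the endomorphism of S_V that
    kills b + u and fixes S_U separates 1/(b+u) from everything regular there
    ([pole_coef_eq0]).  These coefficients are relations in fewer variables.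

    Each normal monomial of total exponent n is homogeneous of degree -n, so
    the spans of the normal monomials of fixed total exponent grade R_V, and
    the grading is unique ([RVdegE]).

    It remains to count.  If U has dimension k, the coset b + U contributes
    either nothing or one of its q^k points with an exponent m >= 1, so the
    number N_(k+1)(n) of normal monomials of degree n in k+1 basis vectors is
      N_k(n) + q^k * (N_k(0) + ... + N_k(n-1)).
    Under the linear map X^j |-> binom(n, j), multiplication by X becomes this
    summation over smaller arguments, by the hockey-stick identity; so N_r(n)
    is the image of the product of the factors 1 + q^(i-1) X for i = 2, ..., r,
    whose expansion over subsets I is h_r(n) ([count_monE], [h_polyE]). *)

Set Implicit Arguments.
Unset Strict Implicit.

(** * The counting recurrence and its closed form *)

(** The number of normal monomials of degree [n] in [k] basis vectors: the last
    vector is absent, or one of the [q ^ k'] poles of its coset occurs with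
    exponent [n - m]. *)
Fixpoint count_mon (q k n : nat) : nat :=
  if k is k'.+1
  then (count_mon q k' n + \sum_(m < n) q ^ k' * count_mon q k' m)%N
  else (n == 0)%N.

(** The functional sending 'X^j to binom(n, j); terms with j > n vanish, which
    permits a summation range depending on [n] only. *)
Definition binom_eval (n : nat) (p : {poly rat}) : rat :=
  \sum_(j < n.+1) p`_j * 'C(n, j)%:R.

Lemma binom_evalE (N n : nat) (p : {poly rat}) : (n < N)%N ->
  binom_eval n p = \sum_(j < N) p`_j * 'C(n, j)%:R.
Proof.
move=> ltnN; rewrite /binom_eval.
rewrite (big_ord_widen N (fun j => p`_j * 'C(n, j)%:R)) // big_mkcond /=.
apply: eq_bigr => j _; case: ifP => // /negbT; rewrite -leqNgt => ltnj.
by rewrite bin_small // mulr0.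
Qed.

Lemma binom_evalD n : {morph binom_eval n : p p' / p + p'}.
Proof.
move=> p p'; rewrite /binom_eval -big_split /=.
by apply: eq_bigr => j _; rewrite coefD mulrDl.
Qed.

Lemma binom_evalZ n a p : binom_eval n (a *: p) = a * binom_eval n p.
Proof.
rewrite /binom_eval mulr_sumr.
by apply: eq_bigr => j _; rewrite coefZ mulrA.
Qed.

Lemma binom_eval0 n : binom_eval n 0 = 0.
Proof. by rewrite -(scale0r 0) binom_evalZ mul0r. Qed.

Lemma binom_evalXn n k : binom_eval n 'X^k = 'C(n, k)%:R.
Proof.
rewrite (binom_evalE _ (ltn_addr k (ltnSn n))).
have ltk : (k < n.+1 + k)%N by rewrite addSn ltnS leq_addl.
rewrite (bigD1 (Ordinal ltk)) //= big1 ?addr0 => [|j nj].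
  by rewrite coefXn eqxx mul1r.
by rewrite coefXn (negPf (nj : val j != k)) mul0r.
Qed.

(** The hockey-stick identity, by induction through Pascal's rule. *)
Lemma binom_evalMX n p : binom_eval n ('X * p) = \sum_(m < n) binom_eval m p.
Proof.
elim: n => [|n IHn].
  rewrite /binom_eval big_ord_recl big_ord0 [in RHS]big_ord0 coefXM.
  by rewrite mul0r addr0.
rewrite big_ord_recr /= -IHn /binom_eval.
rewrite [LHS]big_ord_recl coefXM eqxx mul0r add0r.
under eq_bigr => j _ do rewrite lift0 coefXM /= binS natrD mulrDr.
rewrite big_split /=; congr (_ + _).
have -> : \sum_(i < n.+1) p`_i * 'C(n, i.+1)%:R
   = \sum_(j < n.+2) ('X * p)`_j * 'C(n, j)%:R.
  rewrite [RHS]big_ord_recl coefXM eqxx mul0r add0r.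
  by apply: eq_bigr => j _; rewrite lift0 coefXM.
by rewrite -binom_evalE.
Qed.

(** In degree n and one basis vector there is exactly one normal monomial, which
    starts the product at [i = 2]; every further vector contributes one factor
    because of [binom_evalMX]. *)
Lemma count_monE (q k n : nat) :
  (count_mon q k.+1 n)%:R =
    binom_eval n (\prod_(2 <= i < k.+2) (1 + (q ^ (i - 1))%:R *: 'X)).
Proof.
elim: k n => [|k IHk] n.
  rewrite big_geq // -(expr0 'X) binom_evalXn bin0 /=.
  case: n => [|n]; first by rewrite big_ord0.
  by rewrite add0n big_ord_recl big1.
rewrite [count_mon _ _ _]/= natrD -/(count_mon q k.+1 n) IHk.
rewrite [in RHS]big_nat_recr //= mulrDr mulr1 binom_evalD; congr (_ + _).
rewrite subn1 /= -scalerAr binom_evalZ mulrC [_ * 'X]mulrC binom_evalMX.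
rewrite mulr_suml natr_sum; apply: eq_bigr => m _.
by rewrite natrM mulrC -IHk.
Qed.

(** For [n < k] both sides vanish, as the product contains 'X - n. *)
Lemma binom_poly_nat k n : (binom_poly k).[n%:R] = 'C(n, k)%:R.
Proof.
rewrite hornerZ horner_prod.
under eq_bigr => j _ do rewrite hornerXsubC.
have k0 : k`!%:R != 0 :> rat by rewrite pnatr_eq0 -lt0n fact_gt0.
apply: (mulfI k0); rewrite mulrA divff // mul1r.
rewrite -natrM mulnC bin_ffact ffact_prod.
have [lekn|ltnk] := leqP k n.
  rewrite natr_prod; apply: eq_bigr => j _.
  by rewrite natrB // ltnW // (leq_trans (ltn_ord j)).
rewrite (bigD1 (Ordinal ltnk)) //= subrr mul0r.
by rewrite (bigD1 (Ordinal ltnk)) //= subnn mul0n.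
Qed.

(** Expanding the product amounts to choosing, for each i in {2, ..., r}, the
    term 1 or the term q^(i-1) X, hence to a sum over subsets. *)
Lemma h_polyE q r n :
  (h_poly q r).[n%:R] =
    binom_eval n (\prod_(2 <= i < r.+1) (1 + (q ^ (i - 1))%:R *: 'X)).
Proof.
have -> : \prod_(2 <= i < r.+1) (1 + (q ^ (i - 1))%:R *: 'X) =
    \sum_(I : {set 'I_r.+1} | I \subset [set i : 'I_r.+1 | (2 <= i)%N])
      (q ^ (\sum_(i in I) (i - 1)))%:R *: 'X^#|I| :> {poly rat}.
  set A := [set i : 'I_r.+1 | _].
  (* Padding the factors outside A to 0 + 1 makes the product range over the
     whole index type; subsets not contained in A then contribute 0. *)
  pose w (i : 'I_r.+1) : {poly rat} := (q ^ (i - 1))%:R *: 'X.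
  transitivity (\prod_i ((if i \in A then w i else 0) + 1)).
    rewrite big_geq_mkord big_mkcond /=; apply: eq_bigr => i _.
    by rewrite inE addrC; case: ifP => // _; rewrite add0r.
  rewrite bigA_distr /= [RHS]big_mkcond /=; apply: eq_bigr => I _.
  rewrite -big_mkcond /=.
  have [/subsetP IA|/subsetPn[i iI niA]] := boolP (I \subset A).
    rewrite (eq_bigr w) => [|i /IA -> //].
    rewrite /w scaler_prod prodr_const; congr (_ *: _).
    by rewrite -natr_prod -expn_sum.
  by rewrite (bigD1 i) //= (negPf niA) mul0r.
rewrite /h_poly horner_sum (big_morph _ (binom_evalD n) (binom_eval0 n)).
apply: eq_bigr => I _.
by rewrite hornerZ binom_poly_nat binom_evalZ binom_evalXn.
Qed.

(** * Linear spans of predicates *)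

Definition lin_span (F : fieldType) (L : lmodType F) (S : L -> Prop) (x : L) :=
  forall P : L -> Prop, is_subspace P -> (forall s, S s -> P s) -> P x.

Section Span.
Context (F : fieldType) (L : lmodType F).
Implicit Types (S P : L -> Prop).

Lemma lin_span_subspace S : is_subspace (lin_span S).
Proof.
split=> [P [P0 _] _ //|a u v Su Sv P Psub SP].
by have [_ PD] := Psub; apply: PD; [apply: Su | apply: Sv].
Qed.

Lemma lin_span_in S s : S s -> lin_span S s.
Proof. by move=> Ss P _; apply. Qed.

Lemma lin_span_min S P : is_subspace P -> (forall s, S s -> P s) ->
  forall x, lin_span S x -> P x.
Proof. by move=> Psub SP x; apply. Qed.

Lemma subspaceZ P a x : is_subspace P -> P x -> P (a *: x).
Proof. by move=> [P0 PD] Px; rewrite -[_ *: _]addr0; apply: PD. Qed.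

Lemma subspaceB P x y : is_subspace P -> P x -> P y -> P (x - y).
Proof. by move=> [_ PD] Px Py; rewrite addrC -scaleN1r; apply: PD. Qed.

Lemma lin_span_seq (T : eqType) (s : seq T) (f : T -> L) x :
    uniq s -> lin_span (fun y => exists2 t, t \in s & y = f t) x ->
  exists c : T -> F, x = \sum_(t <- s) c t *: f t.
Proof.
move=> us Sx.
apply: (Sx (fun x => exists c : T -> F, x = \sum_(t <- s) c t *: f t)).
split.
- by exists (fun=> 0); rewrite big1 // => t _; rewrite scale0r.
- move=> a _ _ [c ->] [c' ->]; exists (fun t => a * c t + c' t).
  rewrite scaler_sumr -big_split; apply: eq_bigr => t _ /=.
  by rewrite scalerDl scalerA.
- move=> _ [t0 t0s ->]; exists (fun t => (t == t0)%:R).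
  rewrite (bigD1_seq t0) //= eqxx scale1r big1 ?addr0 // => t /negPf ->.
  by rewrite scale0r.
Qed.

Lemma has_dim_seq (T : eqType) (s : seq T) (f : T -> L) :
    uniq s ->
    (forall c : T -> F, \sum_(t <- s) c t *: f t = 0 ->
       forall t, t \in s -> c t = 0) ->
  has_dim (lin_span (fun y => exists2 t, t \in s & y = f t)) (size s).
Proof.
move=> us fr; exists (fun i => f (tnth (in_tuple s) i)); split.
- move=> i; apply: lin_span_in; exists (tnth (in_tuple s) i) => //.
  exact: mem_tnth.
- move=> c sum0 i.
  (* Coefficients indexed by positions become coefficients indexed by labels,
     which is where repetition-freeness is needed. *)
  pose c' t := if insub (index t s) is Some j then c j else 0.
  have c'E j : c' (tnth (in_tuple s) j) = c j.
    rewrite /c' (tnth_nth (tnth (in_tuple s) j)) /= index_uniq //.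
    by rewrite insubT //= => ltj; congr c; apply: val_inj.
  have si : tnth (in_tuple s) i \in s by exact: mem_tnth.
  rewrite -c'E; apply: fr si; rewrite big_tnth -[RHS]sum0.
  by apply: eq_bigr => j _; rewrite c'E.
- move=> x /(lin_span_seq us)[c ->].
  by exists (fun i => c (tnth (in_tuple s) i)); rewrite big_tnth.
Qed.

Lemma has_dim_ext P Q d :
  (forall x, P x <-> Q x) -> has_dim Q d -> has_dim P d.
Proof.
move=> PQ [e [Qe indep gen]]; exists e; split=> // [i|x Px]; first exact/PQ.
exact/gen/PQ.
Qed.

End Span.

Lemma subalgX (F : fieldType) (A : comAlgType F) (P : A -> Prop) x k :
  is_subalg P -> P x -> P (x ^+ k).
Proof.
move=> [_ P1 PM] Px; elim: k => [|k IHk]; first by rewrite expr0.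
by rewrite exprS; apply: (PM).
Qed.

(** * Normal monomials *)

Section Monomials.
Context (F : finFieldType) (V : vectType F).
Implicit Types (b u v w : V) (bs : seq V) (n m : nat).
Local Notation K := (symfrac V).

Definition points (U : {vspace V}) : seq V :=
  [seq \sum_(i < \dim U) c i *: (vbasis U)`_i | c : {ffun 'I_(\dim U) -> F}].

Lemma mem_points U v : (v \in points U) = (v \in U).
Proof.
apply/imageP/idP => [[c _ ->]|vU].
  by apply: memv_suml => i _; rewrite memvZ // vbasis_mem // mem_nth ?size_tuple.
exists [ffun i => coord (vbasis U) i v] => //.
by rewrite [LHS](coord_vbasis vU); apply: eq_bigr => i _; rewrite ffunE.
Qed.

Lemma points_uniq U : uniq (points U).
Proof.
apply/injectiveP => c c' /(congr1 (fun v i => coord (vbasis U) i v)) eqc.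
apply/ffunP => i; have := congr1 (fun f => f i) eqc.
by rewrite /= !coord_sum_free // (basis_free (vbasisP U)).
Qed.

Lemma size_points U : size (points U) = (#|F| ^ \dim U)%N.
Proof. by rewrite size_image card_ffun card_ord. Qed.

(** The possible contributions of the coset of [b] in degree at most [n].  The
    absence of this coset is recorded as exponent 0 at the single point [b], so
    that all normal monomials have one entry per basis vector. *)
Definition poles b bs n : seq (V * nat) :=
  (b, 0%N) :: [seq (b + u, m) | m <- iota 1 n, u <- points <<bs>>].

(** Exponent lists of the normal monomials of degree [n]; the head of [bs] is
    the last basis vector, the one outside the span of all the others. *)
Fixpoint normal_exps bs n : seq (seq (V * nat)) :=
  if bs is b :: bs'
  then [seq p :: t | p <- poles b bs' n, t <- normal_exps bs' (n - p.2)]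
  else nseq (n == 0%N) [::].

Lemma normal_exps_cons b bs n : normal_exps (b :: bs) n =
  [seq p :: t | p <- poles b bs n, t <- normal_exps bs (n - p.2)].
Proof. by []. Qed.

Definition monomial (t : seq (V * nat)) : K :=
  \prod_(p <- t) sym_inv p.1 ^+ p.2.

Definition mon_span bs n : K -> Prop :=
  lin_span (fun y => exists2 t, t \in normal_exps bs n & y = monomial t).

Lemma mem_poles b bs n p : reflect
    (p = (b, 0%N) \/
     exists m u, [/\ (0 < m <= n)%N, u \in <<bs>>%VS & p = (b + u, m)])
   (p \in poles b bs n).
Proof.
rewrite inE; apply: (iffP predU1P) => -[->|Hp]; [by left|right|by left|right].
  have /allpairsP[[m u] /= [mn uU ->]] := Hp.
  by exists m, u; rewrite -mem_points uU; move: mn; rewrite mem_iota add1n ltnS.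
have [m [u [mn uU ->]]] := Hp.
by apply/allpairsP; exists (m, u) => /=; rewrite mem_points mem_iota add1n ltnS.
Qed.

Lemma poles_uniq b bs n : uniq (poles b bs n).
Proof.
rewrite /= allpairs_uniq ?iota_uniq ?points_uniq ?andbT //.
  apply/negP => /allpairsP[[m u] /= [mn _ [_ m0]]].
  by rewrite mem_iota -m0 in mn.
by move=> [m u] [m' u'] _ _ [/addrI -> ->].
Qed.

Lemma normal_exps_uniq bs n : uniq (normal_exps bs n).
Proof.
elim: bs n => [|b bs IHbs] n; first by rewrite /=; case: (n == 0%N).
rewrite normal_exps_cons.
apply: allpairs_uniq_dep => [|p _|]; rewrite ?poles_uniq //.
by move=> [p t] [p' t'] _ _ /= [-> ->].
Qed.

(** Freeness makes the span of [bs] have q^(size bs) points. *)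
Lemma size_normal_exps bs n : free bs ->
  size (normal_exps bs n) = count_mon #|F| (size bs) n.
Proof.
elim: bs n => [|b bs IHbs] n frb; first by rewrite /= size_nseq.
have frbs : free bs by move: frb; rewrite free_cons => /andP[].
rewrite normal_exps_cons size_allpairs_dep sumnE /poles big_map big_cons /=.
rewrite subn0 IHbs //; congr (_ + _)%N.
rewrite big_allpairs_dep /=.
(* Exponent m leaves degree n - m; reversing the sum lists these by degree. *)
have -> : iota 1 n = index_iota 1 n.+1 by rewrite /index_iota subn1.
rewrite big_add1 big_nat_rev big_mkord; apply: eq_bigr => m _ /=.
rewrite add0n subnSK // subKn ?(ltnW (ltn_ord m)) // IHbs //.
rewrite big_const_seq count_predT iter_addn_0 mulnC size_points.
by move: frbs; rewrite /free => /eqP ->.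
Qed.

(** * Normal monomials span the ring *)

Lemma mon_span_subspace bs n : is_subspace (mon_span bs n).
Proof. exact: lin_span_subspace. Qed.

Lemma subspace_mull (P : K -> Prop) (y : K) :
  is_subspace P -> is_subspace (fun z => P (y * z)).
Proof.
move=> [P0 PD]; split=> [|a u v Pu Pv]; first by rewrite mulr0.
by rewrite mulrDr -scalerAr; apply: PD.
Qed.

Lemma subspace_mulr (P : K -> Prop) (y : K) :
  is_subspace P -> is_subspace (fun z => P (z * y)).
Proof.
move=> [P0 PD]; split=> [|a u v Pu Pv]; first by rewrite mul0r.
by rewrite mulrDl -scalerAl; apply: PD.
Qed.

Lemma monomial_cons p t : monomial (p :: t) = sym_inv p.1 ^+ p.2 * monomial t.
Proof. exact: big_cons. Qed.

(** The uniform way to enter the span of the longer list; for [m = 0] the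
    left factor is 1, which embeds the smaller span into the larger. *)
Lemma mon_span_pole b bs n m u (y : K) : u \in <<bs>>%VS -> mon_span bs n y ->
  mon_span (b :: bs) (n + m) (sym_inv (b + u) ^+ m * y).
Proof.
move=> uU; move: y; apply: lin_span_min.
  exact/subspace_mull/mon_span_subspace.
move=> _ [t tn ->]; apply: lin_span_in.
have [->|m0] := posnP m.
  exists ((b, 0%N) :: t); last by rewrite monomial_cons !expr0.
  rewrite normal_exps_cons; apply/allpairsPdep; exists (b, 0%N), t.
  by rewrite subn0 addn0; split=> //; apply/mem_poles; left.
exists ((b + u, m) :: t); last by rewrite monomial_cons.
rewrite normal_exps_cons; apply/allpairsPdep; exists (b + u, m), t; split=> //.
  by apply/mem_poles; right; exists m, u; rewrite m0 leq_addl.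
by rewrite /= addnK.
Qed.

Lemma mon_span_widen b bs n (y : K) : mon_span bs n y -> mon_span (b :: bs) n y.
Proof.
by move=> /(@mon_span_pole b bs n 0 0 y (mem0v _)); rewrite addn0 mul1r.
Qed.

(** Elimination principle matching [mon_span_pole]: the tail of a normal
    monomial may be replaced by an arbitrary element of the span of the shorter
    list. *)
Lemma mon_span_ind b bs n (P : K -> Prop) : is_subspace P ->
    (forall k m u y, n = (k + m)%N -> u \in <<bs>>%VS -> mon_span bs k y ->
       P (sym_inv (b + u) ^+ m * y)) ->
  forall y, mon_span (b :: bs) n y -> P y.
Proof.
move=> Psub Ppole; apply: lin_span_min => // _
  [_ /allpairsPdep[p [t [/mem_poles pn tn ->]]] ->].
have Pt m u : (m <= n)%N -> u \in <<bs>>%VS -> t \in normal_exps bs (n - m) ->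
    P (sym_inv (b + u) ^+ m * monomial t).
  move=> lemn uU tnm; apply: (Ppole (n - m)%N) => //; first by rewrite subnK.
  by apply: lin_span_in; exists t.
rewrite monomial_cons; case: pn tn => [->|[m [u [/andP[_ lemn] uU ->]]]] tn.
  by rewrite -[b in X in P X]addr0; apply: Pt => //; exact: mem0v.
exact: Pt.
Qed.

Lemma mon_span1 bs : mon_span bs 0 1.
Proof.
elim: bs => [|b bs IHbs]; last exact: mon_span_widen.
by apply: lin_span_in; exists [::]; rewrite ?inE // /monomial big_nil.
Qed.

Lemma mon_span_scale bs n a (y : K) : mon_span bs n y -> mon_span bs n (a *: y).
Proof. exact: (subspaceZ _ (mon_span_subspace bs n)). Qed.

Lemma sym_frac_iota_eq0 v : (sym_frac (sym_iota v) == 0) = (v == 0).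
Proof. by rewrite sym_frac_eq0 sym_iota_eq0. Qed.

Lemma sym_invZ a v : sym_inv (a *: v) = a^-1 *: sym_inv v.
Proof.
have [->|a0] := eqVneq a 0.
  by rewrite invr0 !scale0r /sym_inv linear0 rmorph0 invr0.
have [->|v0] := eqVneq v 0.
  by rewrite scaler0 /sym_inv linear0 rmorph0 invr0 scaler0.
have x0 : sym_frac (sym_iota (a *: v)) != 0.
  by rewrite sym_frac_iota_eq0 scaler_eq0 negb_or a0.
apply: (mulfI x0); rewrite /sym_inv (divff x0) linearZ /= sym_fracZ.
rewrite -scalerAl -scalerAr scalerA (divff a0) scale1r.
by rewrite -sym_frac_iota_eq0 in v0; rewrite (divff v0).
Qed.

(** A vector outside the span of the tail is a scalar multiple of a point of the
    coset of the head. *)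
Lemma mon_span_inv bs v :
  v \in <<bs>>%VS -> v != 0 -> mon_span bs 1 (sym_inv v).
Proof.
elim: bs v => [|b bs IHbs] v; first by rewrite span_nil memv0 => ->.
rewrite span_cons => /memv_addP[_ /vlineP[a ->] [u uU ->]] v0.
have [a0|a0] := eqVneq a 0.
  rewrite a0 scale0r add0r in v0 *.
  by apply: mon_span_widen; apply: IHbs.
have -> : a *: b + u = a *: (b + a^-1 *: u).
  by rewrite scalerDr scalerA divff ?scale1r.
rewrite sym_invZ; apply: mon_span_scale.
rewrite -[sym_inv _]mulr1; apply: (@mon_span_pole b bs 0 1); first exact: memvZ.
exact: mon_span1.
Qed.

Lemma sym_inv_mul v v' : v != 0 -> v' != 0 -> v != v' ->
  sym_inv v * sym_inv v' = sym_inv (v' - v) * (sym_inv v - sym_inv v').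
Proof.
move=> v0 v'0; rewrite eq_sym -subr_eq0; move: v0 v'0.
rewrite -!sym_frac_iota_eq0 /sym_inv linearB rmorphB /=.
move=> v0 v'0 w0; apply: (mulfI w0); rewrite [RHS]mulrA (divff w0) mul1r.
by rewrite mulrBl mulrCA (divff v'0) mulr1 mulrA (divff v0) mul1r.
Qed.

(** Two powers at different points of one coset: the exchange identity
    [sym_inv_mul] lowers one exponent or the other, at the price of the inverse
    of u' - u, which lies in the smaller span; hence the double induction.
    The module structure over the smaller span is an assumption here because it
    comes out of the induction on [bs] in [mon_span_mul]. *)
Lemma mon_span_poles_mul b bs m m' u u' : b \notin <<bs>>%VS ->
    u \in <<bs>>%VS -> u' \in <<bs>>%VS ->
  (forall n n' y y', mon_span bs n y -> mon_span (b :: bs) n' y' ->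
     mon_span (b :: bs) (n + n') (y * y')) ->
  mon_span (b :: bs) (m + m') (sym_inv (b + u) ^+ m * sym_inv (b + u') ^+ m').
Proof.
move=> bU uU u'U Mmod.
have v0 w : w \in <<bs>>%VS -> b + w != 0.
  by move=> wU; apply: contra bU; rewrite addr_eq0 => /eqP ->; rewrite memvN.
have M1 k w : w \in <<bs>>%VS -> mon_span (b :: bs) k (sym_inv (b + w) ^+ k).
  move=> wU; rewrite -[_ ^+ _]mulr1.
  by apply: (@mon_span_pole _ _ 0) => //; exact: mon_span1.
have [<-|neq] := eqVneq u u'; first by rewrite -exprD; apply: M1.
elim: m m' => [|m IHm] m'; first by rewrite mul1r; apply: M1.
elim: m' => [|m' IHm']; first by rewrite mulr1 addn0; apply: M1.
have -> : sym_inv (b + u) ^+ m.+1 * sym_inv (b + u') ^+ m'.+1 =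
    sym_inv (u' - u) * (sym_inv (b + u) ^+ m.+1 * sym_inv (b + u') ^+ m' -
                        sym_inv (b + u) ^+ m * sym_inv (b + u') ^+ m'.+1).
  rewrite !exprS mulrACA sym_inv_mul ?v0 //; last by rewrite (inj_eq (addrI b)).
  rewrite opprD addrACA subrr add0r -[LHS]mulrA; congr (_ * _).
  by rewrite mulrBl; congr (_ - _); [exact: mulrA | exact: mulrCA].
rewrite addnS -add1n.
apply: Mmod.
  by apply: mon_span_inv; [exact: rpredB | rewrite subr_eq0 eq_sym].
apply: (subspaceB (mon_span_subspace _ _)); first exact: IHm'.
by rewrite addSnnS; apply: IHm.
Qed.

(** Eliminating both factors, the tails multiply by induction into the span for
    the tail, which acts on the product of the two head powers, an element of
    the span by [mon_span_poles_mul]. *)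
Lemma mon_span_mul bs n n' (y y' : K) : free bs -> mon_span bs n y ->
  mon_span bs n' y' -> mon_span bs (n + n') (y * y').
Proof.
elim: bs n n' y y' => [|b bs IHbs] n n' y y' frb.
  move=> My My'; have Msub := @mon_span_subspace [::] (n + n').
  move: y My; apply: lin_span_min; first exact: subspace_mulr.
  case: n Msub => [|n] Msub s [t] //; rewrite inE => /eqP -> ->.
  by rewrite /monomial big_nil mul1r.
have /andP[bU frbs] : (b \notin <<bs>>%VS) && free bs by rewrite -free_cons.
have Msub := @mon_span_subspace (b :: bs).
have Mmod k k' z z' : mon_span bs k z -> mon_span (b :: bs) k' z' ->
    mon_span (b :: bs) (k + k') (z * z').
  move=> Mz; move: z'; apply: mon_span_ind; first exact: subspace_mull.
  move=> i m u x -> uU Mx; rewrite mulrCA addnA.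
  by apply: mon_span_pole => //; apply: IHbs.
move=> + My'; move: y; apply: mon_span_ind; first exact: subspace_mulr.
move=> k m u z -> uU Mz; move: y' My'.
apply: mon_span_ind; first exact: subspace_mull.
move=> k' m' u' z' -> u'U Mz'; rewrite addnACA mulrACA mulrC.
apply: (Mmod); first exact: IHbs.
exact: mon_span_poles_mul.
Qed.

(** The general tool for locating normal monomials inside a subalgebra, such as
    R_V or a subfield fixed by an endomorphism. *)
Lemma mon_span_subalg (P : K -> Prop) bs n : is_subalg P ->
    (forall v, v \in <<bs>>%VS -> P (sym_inv v)) ->
  forall y, mon_span bs n y -> P y.
Proof.
move=> [Psub P1 PM]; elim: bs n => [|b bs IHbs] n Pinv.
  apply: lin_span_min => //; case: n => [|n] y [t] //.
  by rewrite inE => /eqP -> ->; rewrite /monomial big_nil.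
apply: mon_span_ind => // k m u y _ uU My.
have Ub w : w \in <<bs>>%VS -> w \in <<b :: bs>>%VS.
  by rewrite span_cons; apply/subvP/addvSr.
apply: (PM); last by apply: IHbs My => v /Ub; apply: (Pinv).
elim: m => [|m IHm] //; rewrite exprS; apply: (PM) => //; apply: (Pinv).
apply: rpredD; last exact: Ub.
by rewrite memv_span ?mem_head.
Qed.

(** * Partial fractions and linear independence *)

(** The local ring of the prime ideal ker e, when [e] is a ring morphism. *)
Definition regular_at (e : sym V -> sym V) (x : K) : Prop :=
  exists f g, e g != 0 /\ x = sym_frac f / sym_frac g.

(** The field of fractions of the ring of [e]-invariants.  For an [e] killing a
    pole b + u it plays the role of a field of constants: its nonzero elements
    are units of the local ring of ker e. *)
Definition fixed_frac (e : sym V -> sym V) (x : K) : Prop :=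
  exists f g, [/\ e f = f, e g = g, g != 0 & x = sym_frac f / sym_frac g].

Lemma frac_linear a (f g f' g' : sym V) : g != 0 -> g' != 0 ->
  a *: (sym_frac f / sym_frac g) + sym_frac f' / sym_frac g' =
    sym_frac (a *: (f * g') + f' * g) / sym_frac (g * g').
Proof.
rewrite -(sym_frac_eq0 g) -(sym_frac_eq0 g') => g0 g'0.
rewrite scalerAl (addf_div _ _ g0 g'0) rmorphD /= sym_fracZ !rmorphM /=.
by rewrite -scalerAl.
Qed.

Lemma frac_mul (f g f' g' : sym V) :
  (sym_frac f / sym_frac g) * (sym_frac f' / sym_frac g') =
    sym_frac (f * f') / sym_frac (g * g').
Proof. by rewrite mulf_div !rmorphM. Qed.

Section Pole.
Variable e : {lrmorphism sym V -> sym V}.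

Lemma regular_at_den_neq0 (g : sym V) : e g != 0 -> g != 0.
Proof. by apply: contraNneq => ->; rewrite rmorph0. Qed.

Lemma regular_at_subalg : is_subalg (regular_at e).
Proof.
split; first split.
- by exists 0, 1; rewrite rmorph1 oner_neq0 rmorph0 mul0r.
- move=> a _ _ [f [g [g0 ->]]] [f' [g' [g'0 ->]]].
  exists (a *: (f * g') + f' * g), (g * g').
  by rewrite rmorphM mulf_neq0 // frac_linear // regular_at_den_neq0.
- by exists 1, 1; rewrite rmorph1 oner_neq0 rmorph1 divr1.
- move=> _ _ [f [g [g0 ->]]] [f' [g' [g'0 ->]]].
  by exists (f * f'), (g * g'); rewrite rmorphM mulf_neq0 // frac_mul.
Qed.

Lemma fixed_frac_subalg : is_subalg (fixed_frac e).
Proof.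
split; first split.
- by exists 0, 1; rewrite rmorph1 oner_neq0 !rmorph0 mul0r.
- move=> a _ _ [f [g [ef eg g0 ->]]] [f' [g' [ef' eg' g'0 ->]]].
  exists (a *: (f * g') + f' * g), (g * g').
  by rewrite frac_linear // mulf_neq0 // linearP !rmorphM /= ef ef' eg eg'.
- by exists 1, 1; rewrite !rmorph1 oner_neq0 divr1.
- move=> _ _ [f [g [ef eg g0 ->]]] [f' [g' [ef' eg' g'0 ->]]].
  exists (f * f'), (g * g').
  by rewrite frac_mul mulf_neq0 // !rmorphM /= ef ef' eg eg'.
Qed.

Lemma fixed_fracV x : fixed_frac e x -> fixed_frac e x^-1.
Proof.
move=> [f [g [ef eg g0 ->]]].
have [->|f0] := eqVneq f 0.
  by rewrite rmorph0 mul0r invr0; have [[]] := fixed_frac_subalg.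
by exists g, f; rewrite invf_div.
Qed.

Lemma fixed_frac_regular x : fixed_frac e x -> regular_at e x.
Proof. by move=> [f [g [_ eg g0 ->]]]; exists f, g; rewrite eg. Qed.

Lemma fixed_frac_sym_inv v :
  e (sym_iota v) = sym_iota v -> fixed_frac e (sym_inv v).
Proof.
move=> ev; apply: fixed_fracV; exists (sym_iota v), 1.
by rewrite !rmorph1 divr1 oner_neq0.
Qed.

Lemma regular_at_sym_inv v : e (sym_iota v) != 0 -> regular_at e (sym_inv v).
Proof. by move=> ev; exists 1, (sym_iota v); rewrite rmorph1 mul1r. Qed.

(** If 1/v = f/g then g = v f lies in ker e. *)
Lemma singular_sym_inv v :
  v != 0 -> e (sym_iota v) = 0 -> ~ regular_at e (sym_inv v).
Proof.
rewrite -sym_frac_iota_eq0 => v0 ev [f [g [eg0 xE]]].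
have g0 : sym_frac g != 0 by rewrite sym_frac_eq0 regular_at_den_neq0.
have gE : g = sym_iota v * f.
  apply: sym_frac_inj; rewrite rmorphM /=.
  apply: (mulfI (invr_neq0 v0)); rewrite mulrA (mulVf v0) mul1r.
  by rewrite -/(sym_inv v) xE (divfK g0).
by move: eg0; rewrite gE rmorphM /= ev mul0r eqxx.
Qed.

End Pole.

(** Uniqueness of polar parts.  The coefficients at each pole vanish by
    descending induction on the exponent: if a/v^(m+1) is the leading term at v,
    multiply the relation by v^m.  Every other term becomes regular at v, so
    a/v is regular there too, although a is a unit and 1/v is not regular. *)
Lemma pole_coef_eq0 (ps : seq (V * nat)) (a : V * nat -> K) : uniq ps ->
    (forall p, p \in ps -> p.1 != 0 /\
       exists e : {lrmorphism sym V -> sym V},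
       [/\ e (sym_iota p.1) = 0,
           forall p', p' \in ps -> p'.1 != p.1 -> e (sym_iota p'.1) != 0
         & forall p', p' \in ps -> fixed_frac e (a p')]) ->
    \sum_(p <- ps) sym_inv p.1 ^+ p.2 * a p = 0 ->
  forall p, p \in ps -> (0 < p.2)%N -> a p = 0.
Proof.
move=> ups psE sum0.
have [N psN] : exists N, forall p, p \in ps -> (p.2 <= N)%N.
  exists (\sum_(p <- ps) p.2)%N => p pps.
  by rewrite (bigD1_seq p) //= leq_addr.
(* Descending induction, phrased for exponents above N - k. *)
suff Q k p : p \in ps -> (N < p.2 + k)%N -> (0 < p.2)%N -> a p = 0.
  by move=> p pps p0; apply: (Q N.+1) => //; rewrite addnS ltnS leq_addl.
elim: k p => [|k IHk] p pps; first by rewrite addn0 ltnNge psN.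
case: p pps => v [|m] //= pps ltN _; apply/eqP/negP => /negP a0.
have [v0 [e [ev evn efix]]] := psE _ pps; rewrite /= in v0 ev evn.
have [[reg0 regP] reg1 regM] := regular_at_subalg e.
have xreg : regular_at e (sym_frac (sym_iota v)).
  by exists (sym_iota v), 1; rewrite !rmorph1 divr1 oner_neq0.
apply: (singular_sym_inv v0 ev).
rewrite -[sym_inv v](mulfK a0); apply: (regM); last first.
  by apply/fixed_frac_regular/fixed_fracV/efix.
have x0 : sym_frac (sym_iota v) != 0 by rewrite sym_frac_iota_eq0.
have -> : sym_inv v * a (v, m.+1) =
    - \sum_(p <- ps | p != (v, m.+1))
        sym_frac (sym_iota v) ^+ m * (sym_inv p.1 ^+ p.2 * a p).
  apply/eqP; rewrite -addr_eq0 -mulr_sumr.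
  move: sum0; rewrite (bigD1_seq (v, m.+1)) //= => /(canRL (addKr _)).
  rewrite addr0 => ->; rewrite mulrN exprSr mulrA mulrA -exprMn.
  by rewrite /sym_inv (divff x0) expr1n mul1r subrr.
rewrite -scaleN1r; apply: (subspaceZ _ (conj reg0 regP)).
rewrite big_seq_cond.
apply: big_rec => [|p' y /andP[p'ps np'] yreg]; first exact: reg0.
have a'reg : regular_at e (a p') by apply/fixed_frac_regular/efix.
have regX := subalgX _ (regular_at_subalg e).
rewrite -[X in X + _]scale1r; apply: (regP) => //.
have [eqv|neqv] := eqVneq p'.1 v; last first.
  apply: (regM); first exact: regX.
  apply: (regM) => //; apply: regX.
  exact/regular_at_sym_inv/evn.
(* At the pole v itself: lower exponents are absorbed by v^m, higher ones have
   coefficient 0 by induction, and exponent m + 1 is excluded from the sum. *)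
have [lem|ltm] := leqP p'.2 m.
  rewrite eqv -(subnK lem) exprD mulrA -[X in X * _]mulrA -exprMn.
  by rewrite /sym_inv (divff x0) expr1n mulr1; apply: (regM) => //; apply: regX.
rewrite IHk ?mulr0 //; last exact: leq_trans ltm.
apply: leq_trans ltN _; rewrite addnS -addSn leq_add2r ltn_neqAle ltm andbT.
by apply: contra np' => /eqP eqm; rewrite [p']surjective_pairing eqv -eqm.
Qed.

(** Induced, through the universal property of S_V, by the linear projection
    with kernel spanned by b + u that is the identity on the span of [bs]. *)
Lemma pole_morphism b bs u : free (b :: bs) -> u \in <<bs>>%VS ->
  exists e : {lrmorphism sym V -> sym V}, e (sym_iota (b + u)) = 0 /\
    forall w, w \in <<bs>>%VS -> e (sym_iota w) = sym_iota w.
Proof.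
move=> frb uU; pose l := coord (in_tuple (b :: bs)) ord0.
have lb : l b = 1 by rewrite /l (@coord_free _ _ _ _ ord0 ord0).
have lU w : w \in <<bs>>%VS -> l w = 0.
  move=> wU; rewrite [w](coord_span (X := in_tuple bs)) // /l linear_sum.
  rewrite big1 // => i _; rewrite linearZ /=.
  by rewrite (coord_free (X := in_tuple (b :: bs)) (lift ord0 i) ord0 frb) mulr0.
pose f v : sym V := sym_iota (v - l v *: (b + u)).
have flin : linear f.
  move=> a v w; rewrite /f -linearP; congr sym_iota.
  have -> : l (a *: v + w) = a * l v + l w by exact: linearP.
  by rewrite scalerBr scalerDl scalerA opprD addrACA.
pose fL : {linear V -> sym V} :=
  HB.pack f (GRing.isLinear.Build F V (sym V) _ f flin).
have [[e eE] _] := sym_universal fL.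
exists e; split=> [|w wU]; rewrite eE /= /f.
  have -> : l (b + u) = l b + l u by exact: linearD.
  by rewrite lb (lU u uU) addr0 scale1r subrr linear0.
by rewrite (lU w wU) scale0r subr0.
Qed.

(** Grouping a relation by the factor at the head of [bs] gives a partial
    fraction relation whose coefficients lie in the field of fractions of S_U,
    U being the span of the tail; each of these coefficients is a shorter
    relation. *)
Lemma monomials_free bs n (c : seq (V * nat) -> F) : free bs ->
    \sum_(t <- normal_exps bs n) c t *: monomial t = 0 ->
  forall t, t \in normal_exps bs n -> c t = 0.
Proof.
elim: bs n c => [|b bs IHbs] n c frb.
  case: n => [|n] //; rewrite /= big_seq1 /monomial big_nil => c0 t.
  by rewrite inE => /eqP ->; apply/eqP; move/eqP: c0;
    rewrite scaler_eq0 oner_eq0 orbF.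
have /andP[bU frbs] : (b \notin <<bs>>%VS) && free bs by rewrite -free_cons.
rewrite normal_exps_cons big_allpairs_dep.
pose a p := \sum_(t <- normal_exps bs (n - p.2)) c (p :: t) *: monomial t.
rewrite (eq_bigr (fun p => sym_inv p.1 ^+ p.2 * a p)); last first.
  move=> p _; rewrite mulr_sumr; apply: eq_bigr => t _.
  by rewrite monomial_cons scalerAr.
move=> sum0; suff a0 p : p \in poles b bs n -> a p = 0.
  move=> t0 /allpairsPdep[p [t [pn tn ->]]].
  exact: (IHbs _ (fun t => c (p :: t)) frbs (a0 p pn)).
have posE p' : p' \in poles b bs n -> exists2 u, u \in <<bs>>%VS & p'.1 = b + u.
  move=> /mem_poles[->|[m [u [_ uU ->]]]]; last by exists u.
  by exists 0; rewrite ?mem0v ?addr0.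
have pos p' : p' \in poles b bs n -> (0 < p'.2)%N -> a p' = 0.
  apply: (pole_coef_eq0 (poles_uniq b bs n) _ sum0) => p1 /posE[u uU ->]; split.
    by apply: contra bU; rewrite addr_eq0 => /eqP ->; rewrite memvN.
  have [e [eu ew]] := pole_morphism frb uU; exists e; split=> // p2.
    move=> /posE[u' u'U ->] neq.
    have -> : b + u' = (b + u) + (u' - u) by rewrite -addrA [u + _]addrC subrK.
    rewrite linearD rmorphD /= eu add0r ew ?rpredB // sym_iota_eq0 subr_eq0.
    by apply: contraNneq neq => ->.
  move=> _.
  apply: (mon_span_subalg (bs := bs) (n := n - p2.2) (fixed_frac_subalg e))
    => [v vU|].
    by apply: fixed_frac_sym_inv; exact: ew.
  rewrite /a big_seq; apply: big_rec => [|t y tn My].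
    by have [] := mon_span_subspace bs (n - p2.2).
  have [_ P] := mon_span_subspace bs (n - p2.2).
  by apply: P => //; apply: lin_span_in; exists t.
(* Once the polar coefficients vanish, only the entry of exponent 0 is left. *)
case: p => v [|m] pn; last exact: pos.
have vE : v = b.
  case/mem_poles: pn => [[]|[m [u [/andP[m0 _] _ [_ mE]]]]] //.
  by rewrite -mE in m0.
rewrite vE in pn *; move: sum0.
rewrite (bigD1_seq (b, 0%N)) ?poles_uniq //= expr0 mul1r.
rewrite big_seq_cond big1 ?addr0 // => p' /andP[p'n neq].
rewrite pos ?mulr0 //; rewrite lt0n; apply: contra neq.
case/mem_poles: p'n => [-> //|[m [u [/andP[m0 _] _ ->]]]].
by rewrite /= -leqn0 leqNgt m0.
Qed.

(** * The grading by normal monomials *)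

Lemma mon_span_RV bs n y : mon_span bs n y -> RV y.
Proof.
apply: mon_span_subalg; first exact: RV_subalg.
move=> v _; have [[R0 _] _ _] := @RV_subalg F V.
have [->|v0] := eqVneq v 0; last by have [] := RVdeg_inv v0.
by rewrite /sym_inv linear0 rmorph0 invr0.
Qed.

Section Grading.
Hypothesis dimV_gt0 : (0 < \dim {:V})%N.

Lemma symfrac_homog_subspace d : is_subspace (@symfrac_homog F V d).
Proof. by split=> [|a u v]; [exact: symfrac_homog0 | exact: symfrac_homogP]. Qed.

Lemma mon_span_homog bs n y : mon_span bs n y -> symfrac_homog (- n%:Z) y.
Proof.
elim: bs n y => [|b bs IHbs] n.
  apply: lin_span_min => [|s [t]]; first exact: symfrac_homog_subspace.
  case: n => [|n] //; rewrite inE => /eqP -> ->.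
  by rewrite /monomial big_nil oppr0; exact: symfrac_homog1.
apply: mon_span_ind => [|k m u y -> uU My]; first exact: symfrac_homog_subspace.
rewrite addnC PoszD opprD; apply: symfrac_homogM; last exact: IHbs.
elim: m => [|m IHm]; first by rewrite expr0 oppr0; exact: symfrac_homog1.
rewrite exprS -add1n PoszD opprD; apply: symfrac_homogM => //.
have [->|v0] := eqVneq (b + u) 0; last exact: symfrac_homog_inv.
by rewrite /sym_inv linear0 rmorph0 invr0; apply: symfrac_homog0.
Qed.

Definition mon_part (d : int) (y : K) : Prop :=
  if d <= 0 then mon_span (vbasis {:V}) `|d|%N y else y = 0.

Lemma mon_part_subspace d : is_subspace (mon_part d).
Proof.
rewrite /mon_part; case: (d <= 0); first exact: mon_span_subspace.
split=> [|a u v -> ->] //.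
by rewrite scaler0 addr0.
Qed.

Lemma mon_part_RVdeg d y : mon_part d y -> RVdeg d y.
Proof.
rewrite /mon_part; case: ifP => [d0 My|_ ->].
  split; first exact: mon_span_RV My.
  by have := mon_span_homog My; rewrite abszE ler0_norm // opprK.
by have [] := RVdeg_subspace dimV_gt0 d.
Qed.

Lemma mon_part1 : mon_part 0 1.
Proof. exact: mon_span1. Qed.

Lemma mon_partM d d' y y' :
  mon_part d y -> mon_part d' y' -> mon_part (d + d') (y * y').
Proof.
have [M0 _] := mon_part_subspace (d + d').
rewrite {1 2}/mon_part; case: ifP => [d0 My|_ ->]; last by rewrite mul0r.
case: ifP => [d'0 My'|_ ->]; last by rewrite mulr0.
rewrite /mon_part ler_wnDl //.
have -> : absz (d + d') = (absz d + absz d')%N.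
  by apply/eqP; rewrite -eqz_nat PoszD !abszE !ler0_norm ?opprD // ler_wnDl.
by apply: mon_span_mul => //; apply: basis_free (vbasisP _).
Qed.

Lemma mon_part_inv v : v != 0 -> mon_part (- 1) (sym_inv v).
Proof.
by move=> v0; apply: mon_span_inv => //; rewrite (span_basis (vbasisP _)) memvf.
Qed.

Lemma mon_part_grading : is_grading (@RV F V) mon_part.
Proof.
split.
- move=> d; split=> [|y /mon_part_RVdeg[] //]; exact: mon_part_subspace.
- by split; [exact: mon_part1 | exact: mon_partM].
- move=> y Ry.
  have [t tM ->] := RV_sum_homog mon_part_subspace mon_part1 mon_partM
    mon_part_inv Ry.
  exact: sum_homogP mon_part_subspace tM.
- move=> s y us My; apply: symfrac_homog_indep => // d.
  by have [] := mon_part_RVdeg (My d).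
Qed.

(** Both sides grade R_V with every 1/v in degree -1, and there is only one such
    grading. *)
Lemma RVdegE d y : RVdeg d y <-> mon_part d y.
Proof.
apply: iff_sym; apply: RVdeg_unique => //; first exact: mon_part_grading.
exact: mon_part_inv.
Qed.

End Grading.

End Monomials.

Unset Implicit Arguments.
Set Strict Implicit.

Theorem theorem1p10 (F : finFieldType) (q : nat) (cardF : #|F| = q)
    (V : vectType F) (r : nat) (dimV : \dim {:V} = r) (r_ge1 : (1 <= r)%N)
    (n : int) :
  exists2 d : nat, has_dim (@RVdeg F V (- n)) d &
    d%:R = (if 0 <= n then (h_poly q r).[n%:~R] else 0) :> rat.
Proof.
have dimV_gt0 : (0 < \dim {:V})%N by rewrite dimV.
have frb : free (vbasis {:V}) := basis_free (vbasisP _).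
have degE := RVdegE dimV_gt0 (- n); rewrite /mon_part oppr_le0 abszN in degE.
case: n degE => [n|n] degE; last first.
  exists 0%N => //; apply: (has_dim_ext degE).
  exists (fun=> 0); split=> [//|c _ []//|x ->].
  by exists (fun=> 0); rewrite big_ord0.
exists (size (normal_exps (vbasis {:V}) n)).
  apply: (has_dim_ext degE); apply: has_dim_seq; first exact: normal_exps_uniq.
  by move=> c; apply: monomials_free.
rewrite size_normal_exps // size_tuple cardF dimV.
by case: r r_ge1 {dimV} => // r _; rewrite count_monE -h_polyE.
Qed.
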